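(* Let $X$ and $Y$ be real valued random variables such that $\mathbb{E}|Y|<\infty$ and such that for all non-decreasing convex $\varphi:\mathbb{R}\to\mathbb{R}$, the expectations $\mathbb{E}\varphi(X)$ and $\mathbb{E}\varphi(Y)$ are well defined elements of $[-\infty,\infty]$ and $\mathbb{E}\varphi(X)\leq\mathbb{E}\varphi(Y)$. Let $x\in(0,1)$ and $R>1$, and assume that \[ H_Y^*(x/R)\geq\frac{1}{x}\int_0^xH_Y^*(u)\,du. \] Then \[ \mathbb{P}\{X>t\}\leq R\,\mathbb{P}\{Y\geq t\},\qquad\text{where } t=\frac{1}{x}\int_0^xH_Y^*(u)\,du. \] Moreover, for every real $t>\mathbb{E}Y$ such that $\mathbb{P}\{Y>t\}\neq 0$, there exists $x\in(0,1)$ such that $t=\frac{1}{x}\int_0^xH_Y^*(u)\,du$.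
   Context: For a real valued random variable $Y$ with cumulative distribution function $F_Y(t)=\mathbb{P}\{Y\leq t\}$, the quantile function $H_Y:(0,1)\to\mathbb{R}$ is defined by $H_Y(s)=\inf\{t\in\mathbb{R}:F_Y(t)\geq s\}$, and $H_Y^*:(0,1)\to\mathbb{R}$ is defined by $H_Y^*(x)=H_Y(1-x)$. $X$ and $Y$ need not be defined on the same probability space. *)

(* Defs.v *)
From HB Require Import structures.
From mathcomp Require Import all_boot all_order all_algebra.
From mathcomp Require Import all_classical all_reals all_analysis.
Import Order.TTheory GRing.Theory Num.Theory.
Import numFieldNormedType.Exports.

Set Implicit Arguments.
Unset Strict Implicit.
Unset Printing Implicit Defensive.

Local Open Scope classical_set_scope.
Local Open Scope ring_scope.

(* In [\bar R] the sum of +oo and -oo is totalized to -oo, so an expectation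
   always has a value; it is well defined in [-oo, +oo] when the expectations of
   the positive and negative parts are not both infinite. *)
Definition expectation_defined (d : measure_display) (T : measurableType d)
    (R : realType) (P : probability T R) (f : T -> R) : Prop :=
  ((\int[P]_w ((EFin \o f)^\+ w)) +? (- \int[P]_w ((EFin \o f)^\- w)))%E.

(* For 0 < s < 1 the set is nonempty and bounded below, so [inf] is the genuine
   infimum; for other s the value is meaningless. *)
Definition quantile (d : measure_display) (T : measurableType d)
    (R : realType) (P : probability T R) (Y : {RV P >-> R}) (s : R) : R :=
  inf [set t : R | (s%:E <= cdf Y t)%E].

Definition upper_quantile (d : measure_display) (T : measurableType d)
    (R : realType) (P : probability T R) (Y : {RV P >-> R}) (x : R) : R :=
  quantile Y (1 - x).

(* [Rintegral] is 0 when the integral is infinite. This does not happen for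
   0 < x < 1 and Y integrable. *)
Definition upper_quantile_mean (d : measure_display) (T : measurableType d)
    (R : realType) (P : probability T R) (Y : {RV P >-> R}) (x : R) : R :=
  x^-1 * \int[lebesgue_measure]_(u in `]0, x[) upper_quantile Y u.

(* Main.v *)
(* Put s = H^*(x) and t = (1/x) int_0^x H^*.  The Galois connection
   y < H^*(u) <-> u < P(Y > y) shows that H^* carries Lebesgue measure on
   ]0, 1[ to the law of Y, so E (Y - s)^+ = int_0^x (H^* - s) = x (t - s).
   Applying the hypothesis to phi(y) = (y - s)^+, Markov's inequality gives
   (t - s) P(X > t) <= x (t - s), i.e. P(X > t) <= x (when s = t, the positive
   part (X - t)^+ vanishes almost surely).  The condition t <= H^*(x / K) says
   that Y >= t has probability at least x / K.
   For the last claim, apply the intermediate value theorem to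
   x |-> int_0^x H^* - x t, which is negative at 1 because its value there is
   E Y - t, and nonnegative at half of P(Y > t) because H^* > t to its left. *)
Require Import Defs.
From HB Require Import structures.
From mathcomp Require Import all_boot all_order all_algebra.
From mathcomp Require Import all_classical all_reals all_analysis.
From mathcomp Require Import measurable_realfun.
From mathcomp Require Import lra.
Import Order.TTheory GRing.Theory Num.Theory.
Import numFieldNormedType.Exports.

Local Open Scope classical_set_scope.
Local Open Scope ring_scope.

(** * The upper quantile function: Galois connection and monotonicity *)

Section upper_quantile.
Context {R : realType} {d : measure_display} {T : measurableType d}.
Context {Q : probability T R} (Y : {RV Q >-> R}).

(** Right continuity of the cdf. The room gained to the right of [y] is what makes the inequality
    for the infimum below strict. *)
Lemma lt_cdf_right_of (y c : R) : (cdf Y y < c%:E)%E ->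
  exists2 z, y < z & (cdf Y z < c%:E)%E.
Proof.
move=> yc.
have near_lt : \forall z \near y^'+, (cdf Y z < c%:E)%E.
  apply: (@cdf_right_continuous _ _ _ _ Y y [set z | (z < c%:E)%E]).
  apply: open_nbhs_nbhs; split => //; exact: open_ereal_lt_ereal.
near (y^'+) => z; exists z; last by near: z.
by near: z; exact: nbhs_right_gt.
Unshelve. all: by end_near. Qed.

(** The set [S] below is upward closed and, by right continuity, contains its infimum, so lying
    strictly below the infimum amounts to lying outside [S]. *)
Lemma lt_upper_quantile (u y : R) : 0 < u < 1 ->
  (y < upper_quantile Y u) = (u%:E < ccdf Y y)%E.
Proof.
move=> /andP[u0 u1].
pose S := [set t : R | ((1 - u)%:E <= cdf Y t)%E].
(* The limits of the cdf at +oo and -oo make [S] nonempty and bounded below, so that [inf] is not a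
   default value. *)
have S0 : S !=set0.
  have h : \forall z \near +oo, ((1 - u)%:E < cdf Y z)%E.
    apply: (@cvg_cdfy1 _ _ _ _ Y [set z | ((1 - u)%:E < z)%E]).
    apply: open_nbhs_nbhs; split; first exact: open_ereal_gt_ereal.
    by rewrite /= lte_fin; lra.
  near (+oo : set_system R) => z; exists z.
  by apply/ltW; near: z.
have lbS (y' : R) : (cdf Y y' < (1 - u)%:E)%E -> lbound S y'.
  move=> y'u t St; rewrite leNgt; apply/negP => ty'.
  move: (le_lt_trans St (le_lt_trans (cdf_nondecreasing Y (ltW ty')) y'u)).
  by rewrite ltxx.
have Slb : has_lbound S.
  have h : \forall z \near -oo, (cdf Y z < (1 - u)%:E)%E.
    apply: (@cvg_cdfNy0 _ _ _ _ Y [set z | (z < (1 - u)%:E)%E]).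
    apply: open_nbhs_nbhs; split; first exact: open_ereal_lt_ereal.
    by rewrite /= lte_fin; lra.
  near (-oo : set_system R) => z; exists z; apply: lbS.
  by near: z.
have -> : (u%:E < ccdf Y y)%E = (cdf Y y < (1 - u)%:E)%E.
  have : cdf Y y \is a fin_num by rewrite fin_num_measure.
  rewrite ccdf_1_cdf; case: (cdf Y y) => [r _| |] //.
  by rewrite -EFinB !lte_fin ltrBrDr addrC -ltrBrDr.
apply/idP/idP => [yH|/lt_cdf_right_of[z yz zu]].
  rewrite ltNge; apply/negP => ?.
  by move: yH; rewrite ltNge => /negP; apply; exact: ge_inf.
by apply: (lt_le_trans yz); apply: lb_le_inf => //; exact: lbS.
Unshelve. all: by end_near. Qed.

Lemma upper_quantile_nonincreasing (u v : R) : 0 < u -> u <= v -> v < 1 ->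
  upper_quantile Y v <= upper_quantile Y u.
Proof.
move=> u0 uv v1; rewrite leNgt; apply/negP.
have u01 : 0 < u < 1 by lra.
have v01 : 0 < v < 1 by lra.
(* The Galois connection is used at the level [upper_quantile Y u] itself: a tail mass above [v]
   there exceeds [u] as well. *)
rewrite lt_upper_quantile// => h.
suff : upper_quantile Y u < upper_quantile Y u by rewrite ltxx.
by rewrite lt_upper_quantile// (le_lt_trans _ h)// lee_fin.
Qed.

(** * Transport of Lebesgue measure on []0, 1[] to the law of [Y] *)

Local Notation mu := (@lebesgue_measure R).

Lemma measurable_upper_quantile :
  measurable_fun (`]0, 1[ : set R) (upper_quantile Y : R -> R).
Proof.
apply: (measurability (@RGenOInfty.G R)) => [|/= _ [_] [r] -> <-].
  exact: RGenOInfty.measurableE.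
(* By monotonicity, the preimage of an open upper half-line is an interval. *)
apply: is_interval_measurable => s t/=.
rewrite !in_itv/= !andbT => -[s01 rs] [t01 rt] u /andP[su ut]; split.
  by rewrite /= in_itv/=; lra.
by rewrite in_itv/= andbT (lt_le_trans rt)//
  upper_quantile_nonincreasing//; lra.
Qed.

(* Outside ]0, 1[ the quantile is a junk value, hence the restriction. *)
Let H01 : R -> R := upper_quantile Y \_ `]0, 1[.

Let measurable_H01 : measurable_fun [set: R] H01.
Proof.
by apply/(measurable_restrictT (upper_quantile Y : R -> R)) => //;
  exact: measurable_upper_quantile.
Qed.

(** Seen under this probability, [H01] becomes a random variable whose [distribution] can be
    compared with that of [Y]. *)
Let U := uniform_prob (@ltr01 R).

Let ge0_integral_U (f : R -> \bar R) : measurable_fun [set: R] f ->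
  (forall x, 0 <= f x)%E ->
  (\int[U]_u f u = \int[mu]_(u in `]0%R, 1%R[) f u)%E.
Proof.
move=> mf f0; rewrite integral_uniform// subr0 invr1 mul1e.
rewrite -integral_itv_bndo_bndc; last exact: measurable_funTS.
by rewrite -integral_itv_obnd_cbnd//; exact: measurable_funTS.
Qed.

Let H01_mfun : {mfun measurableTypeR R >-> R} :=
  @mfun_Sub _ _ (measurableTypeR R) R H01 (mem_set measurable_H01).

Let HU : {RV U >-> R} := H01_mfun.

Let U_itv (A : set R) : measurable A -> U A = mu (A `&` `]0, 1[).
Proof.
move=> mA; have -> : U A = (\int[U]_u (\1_A u)%:E)%E.
  by rewrite integral_indic// setIT.
rewrite ge0_integral_U ?integral_indic//.
exact/measurable_EFinP/measurable_indic.
Qed.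

(** Open upper half-lines are stable under intersection and generate the Borel sets, so it suffices
    to compare the two laws on them. *)
Let distribution_H01 (A : set R) : measurable A ->
  distribution U HU A = distribution Q Y A.
Proof.
apply: (measure_unique (@RGenOInfty.G R) (fun n : nat => `]- n%:R, +oo[%classic)
         _ _ _ _ (distribution U HU) (distribution Q Y)).
- exact: RGenOInfty.measurableE.
- move=> _ _ [x ->] [y ->]; exists (Num.max x y).
  by apply/seteqP; split => z; rewrite /= !in_itv/= !andbT gt_max => /andP.
- by move=> n; exists (- n%:R).
- apply/seteqP; split => // z _; exists (Num.bound `|z|) => //=.
  rewrite in_itv/= andbT ltrNl (le_lt_trans _ (archi_boundP (normr_ge0 z)))//.
  by rewrite -normrN ler_norm.
- move=> _ [y ->].
  have p01 : (0 <= ccdf Y y <= 1)%E by rewrite measure_ge0 probability_le1.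
  rewrite -[RHS]/(ccdf Y y).
  transitivity (mu (H01 @^-1` `]y, +oo[ `&` `]0, 1[)).
    by apply: U_itv; rewrite -[X in measurable X]setTI; exact: measurable_H01.
  case: (ccdf Y y) (lt_upper_quantile^~ y) p01 => [p||] // Hp;
    last by rewrite leye_eq andbF.
  rewrite !lee_fin => /andP[p0 p1].
  (* With [p] the tail mass of [Y] beyond [y], the Galois connection identifies the superlevel set,
     whose length is then [p]. *)
  rewrite (_ : _ `&` _ = `]0, p[%classic); last first.
    apply/seteqP; split => u; rewrite /= !in_itv/= andbT.
      by move=> [+ u01]; rewrite /H01 patchE mem_set// Hp// lte_fin; lra.
    move=> u0p; have u01 : 0 < u < 1 by lra.
    by rewrite /H01 patchE mem_set//= Hp// lte_fin; lra.
  rewrite lebesgue_measure_itv/= lte_fin; case: ltP => [|p0'].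
    by rewrite sube0.
  by congr EFin; lra.
- by move=> n; apply: (@le_lt_trans _ _ 1%E);
    [exact: probability_le1|exact: ltry].
Qed.

Lemma ge0_integral_upper_quantile (f : R -> \bar R) :
  measurable_fun [set: R] f -> (forall x, 0 <= f x)%E ->
  (\int[mu]_(u in `]0%R, 1%R[) f (upper_quantile Y u) = \int[Q]_w f (Y w))%E.
Proof.
move=> mf f0; transitivity (\int[U]_u f (HU u))%E.
  rewrite ge0_integral_U//; last exact: measurableT_comp.
  by apply: eq_integral => u u01; rewrite /HU /= /H01 patchE u01.
rewrite -[LHS]ge0_integral_distribution// -[RHS]ge0_integral_distribution//.
by apply: eq_measure_integral => A mA _; exact: distribution_H01.
Qed.

Lemma upper_quantile_distribution (A : set R) : measurable A ->
  mu (upper_quantile Y @^-1` A `&` `]0, 1[) = distribution Q Y A.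
Proof.
move=> mA; rewrite -distribution_H01//.
transitivity (mu (H01 @^-1` A `&` `]0, 1[)); last first.
  by apply/esym/U_itv; rewrite -[X in measurable X]setTI; exact: measurable_H01.
congr mu; apply/seteqP; split => u [Au u01]; split => //; move: Au.
  by rewrite /H01 /= patchE mem_set.
by rewrite /H01 /= patchE mem_set.
Qed.

Lemma integral_upper_quantile :
  (\int[mu]_(u in `]0%R, 1%R[) (upper_quantile Y u)%:E = 'E_Q[Y])%E.
Proof.
(* Positive and negative parts are transported separately by the change of variables for nonnegative
   functions. *)
rewrite expectation_def integralE [RHS]integralE; congr (_ - _)%E.
  transitivity (\int[Q]_w ((@EFin R)^\+ (Y w)))%E.
    rewrite -ge0_integral_upper_quantile//.
      by apply: eq_integral => u _; rewrite !funeposE.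
    by apply: measurable_funepos; exact/measurable_EFinP.
  by apply: eq_integral => u _; rewrite !funeposE.
transitivity (\int[Q]_w ((@EFin R)^\- (Y w)))%E.
  rewrite -ge0_integral_upper_quantile//.
    by apply: eq_integral => u _; rewrite !funenegE.
  by apply: measurable_funeneg; exact/measurable_EFinP.
by apply: eq_integral => u _; rewrite !funenegE.
Qed.

(** * Means of the upper quantile function for integrable [Y] *)

Hypothesis intY : ('E_Q[fun w => `|Y w|%R] < +oo)%E.

Lemma integrable_upper_quantile :
  mu.-integrable `]0, 1[ (EFin \o upper_quantile Y).
Proof.
apply/integrableP; split.
  by apply/measurable_EFinP; exact: measurable_upper_quantile.
move: intY; rewrite unlock.
rewrite -(ge0_integral_upper_quantile (fun y => `|y%:E|)%E)//.
by apply: measurableT_comp => //; exact/measurable_EFinP.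
Qed.

Lemma Rintegral_upper_quantile (x : R) : x != 0 ->
  \int[mu]_(u in `]0, x[) upper_quantile Y u = x * upper_quantile_mean Y x.
Proof. by move=> x0; rewrite /upper_quantile_mean mulVKf. Qed.

(** After transport to []0, 1[], monotonicity shows that the positive part is the difference itself
    on []0, x[] and zero on [[x, 1[]. *)
Lemma expectation_excess_upper_quantile (x : R) : 0 < x < 1 ->
  (\int[Q]_w (Num.max (Y w - upper_quantile Y x) 0)%:E =
   (x * (upper_quantile_mean Y x - upper_quantile Y x))%:E)%E.
Proof.
move=> /andP[x0 x1]; set s := upper_quantile Y x.
have mmax : measurable_fun [set: R] (fun y => (Num.max (y - s) 0)%:E).
  apply/measurable_EFinP; apply: measurable_maxr => //.
  exact: measurable_funB.
rewrite -(ge0_integral_upper_quantile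
  (fun y => (Num.max (y - s) 0)%:E))//; last first.
  by move=> y; rewrite lee_fin le_max lexx orbT.
have mmaxH : measurable_fun (`]0, 1[ : set R)
    (fun u => (Num.max (upper_quantile Y u - s) 0)%:E).
  exact: (measurableT_comp mmax measurable_upper_quantile).
have sub0x : (`]0, x[ `<=` `]0, 1[)%classic.
  by apply: subset_itvl; rewrite bnd_simp ltW.
have intx : mu.-integrable `]0, x[ (EFin \o upper_quantile Y).
  by apply: integrableS integrable_upper_quantile.
have mu0x : mu `]0, x[ = x%:E.
  by rewrite lebesgue_measure_itv/= lte_fin x0 sube0.
have intcst : mu.-integrable `]0, x[ (fun=> s%:E).
  apply/integrableP; split; first exact: measurable_cst.
  by rewrite integral_cst//= lte_mul_pinfty// mu0x ltry.
have split01 : `]0, 1[%classic = `]0, x[ `|` `[x, 1[.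
  by rewrite -itv_bndbnd_setU// bnd_simp// ltW.
rewrite split01 ge0_integral_setU//; last 3 first.
- by rewrite -split01.
- by move=> u _; rewrite lee_fin le_max lexx orbT.
- apply/disj_set2P; rewrite -subset0 => u [] /=; rewrite !in_itv/=; lra.
rewrite [X in (_ + X)%E]integral0_eq ?adde0; last first.
  move=> u /=; rewrite in_itv/= => xu; congr EFin; apply/max_idPr.
  by rewrite subr_le0 upper_quantile_nonincreasing//; lra.
transitivity (\int[mu]_(u in `]0%R, x[) ((upper_quantile Y u)%:E - s%:E))%E.
  apply: eq_integral => u; rewrite inE/= in_itv/= => ux; rewrite -EFinB; congr EFin.
  apply/max_idPl.
  by rewrite subr_ge0 upper_quantile_nonincreasing//; lra.
rewrite integralB// integral_cst// mulrBr EFinB; congr (_ - _)%E.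
  by rewrite -Rintegral_upper_quantile ?gt_eqF// /Rintegral fineK//;
    exact: integrable_fin_num.
by rewrite mulrC EFinM; congr (_ * _)%E.
Qed.

(** The difference of the two sides, times [x], is an expected excess and hence nonnegative. *)
Lemma upper_quantile_le_mean (x : R) : 0 < x < 1 ->
  upper_quantile Y x <= upper_quantile_mean Y x.
Proof.
move=> x01; rewrite -subr_ge0 -(pmulr_rge0 _ (andP x01).1) -lee_fin.
rewrite -expectation_excess_upper_quantile//; apply: integral_ge0 => w _.
by rewrite lee_fin le_max lexx orbT.
Qed.

Lemma upper_quantile_mean1 : ((upper_quantile_mean Y 1)%:E = 'E_Q[Y])%E.
Proof.
rewrite -integral_upper_quantile /upper_quantile_mean invr1 mul1r.
by rewrite /Rintegral fineK//; apply: integrable_fin_num => //;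
  exact: integrable_upper_quantile.
Qed.

(** [parameterized_integral] works on closed intervals; the junk values at 0 and 1 sit on a null
    set. *)
Lemma integrable_upper_quantile_cc :
  mu.-integrable `[0, 1] (EFin \o upper_quantile Y).
Proof.
have /integrableP[mH intH] := integrable_upper_quantile.
have mHc : measurable_fun (`[0, 1] : set R) (EFin \o upper_quantile Y).
  exact: emeasurable_fun_itv_cc mH.
apply/integrableP; split => //; rewrite -integral_itv_bndo_bndc; last first.
  by apply: measurableT_comp => //; apply/emeasurable_fun_itv_bndo_bndcP.
rewrite -integral_itv_obnd_cbnd//; exact: measurableT_comp.
Qed.

Lemma parameterized_integral_upper_quantile (x : R) : 0 < x <= 1 ->
  parameterized_integral mu 0 x (upper_quantile Y) =
  x * upper_quantile_mean Y x.
Proof.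
move=> /andP[x0 x1]; rewrite -Rintegral_upper_quantile ?gt_eqF//.
rewrite /parameterized_integral -Rintegral_itv_bndo_bndc; last first.
  apply: (integrableS _ _ _ integrable_upper_quantile_cc) => //.
  by apply: subset_itvl; rewrite bnd_simp.
rewrite -Rintegral_itv_obnd_cbnd//.
apply: (integrableS _ _ _ integrable_upper_quantile) => //.
by apply: subset_itvl; rewrite bnd_simp.
Qed.
End upper_quantile.

(** * Tail bounds from the expected excess over a level *)

Section excess.
Context {R : realType} {d : measure_display} {T : measurableType d}.
Context {P : probability T R} (X : {RV P >-> R}).

Let measurable_excess (s : R) :
  measurable_fun [set: T] (fun w => (Num.max (X w - s) 0)%:E).
Proof.
apply/measurable_EFinP; apply: measurable_maxr => //.
exact: measurable_funB.
Qed.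

Let measurable_tail (t : R) : measurable [set w | t < X w].
Proof.
rewrite (_ : [set w | _] = X @^-1` `]t, +oo[).
  by rewrite -[X in measurable X]setTI; exact: measurable_funP.
by apply/seteqP; split => w /=; rewrite in_itv/= andbT.
Qed.

(** Markov's inequality: the excess over [s] is at least [t - s] on the tail event and nonnegative
    elsewhere. *)
Lemma excess_markov (s t : R) : s <= t ->
  ((t - s)%:E * P [set w | (t < X w)%R] <=
   \int[P]_w (Num.max (X w - s) 0)%:E)%E.
Proof.
move=> st; rewrite -[X in P X]setIT -integral_indic//.
rewrite -ge0_integralZl//; last 2 first.
- exact/measurable_EFinP/measurable_indic.
- by rewrite lee_fin subr_ge0.
apply: ge0_le_integral => //.
- by move=> w _; rewrite mule_ge0// lee_fin ?subr_ge0.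
- apply: emeasurable_funM => //; exact/measurable_EFinP/measurable_indic.
- move=> w _; rewrite indicE -EFinM lee_fin le_max.
  have [/set_mem/= tX|_] := boolP (w \in _); last by rewrite mulr0 lexx orbT.
  by rewrite mulr1 lerB// ltW.
Qed.

(** Covers the case [s = t], where the factor [t - s] in [excess_markov] is zero: a nonnegative
    function with zero integral vanishes almost everywhere. *)
Lemma excess_eq0 (t : R) :
  (\int[P]_w (Num.max (X w - t) 0)%:E = 0 -> P [set w | (t < X w)%R] = 0)%E.
Proof.
move=> int0.
have /(ae_eq_integral_abs P measurableT (measurable_excess t)).1 :
    (\int[P]_w `|(Num.max (X w - t) 0)%:E| = 0)%E.
  rewrite -[RHS]int0; apply: eq_integral => w _.
  by rewrite gee0_abs// lee_fin le_max lexx orbT.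
move=> [N [mN N0 subN]]; apply/eqP; rewrite -measure_le0 -N0.
apply: le_measure; rewrite ?inE// => w /= tX; apply: subN => /= /(_ I) [] /eqP.
by rewrite maxEle subr_le0 leNgt tX/= subr_eq0 gt_eqF.
Qed.
End excess.

Lemma convex_excess (R : realType) (s : R) :
  convex_function ([set: R^o] : set (convex_lmodType R^o))
    (fun y => Num.max (y - s) 0).
Proof.
move=> t a b _ _; rewrite !convRE.
(* Retyping the points from [R^o] to [R] leaves an inequality between reals. *)
change (Num.max ((t%:num : R) * (a : R) + (1 - t%:num) * (b : R) - s) 0 <=
  (t%:num : R) * Num.max ((a : R) - s) 0 +
  (1 - t%:num) * Num.max ((b : R) - s) 0).
have q0 : 0 <= (t%:num : R) by [].
have : 0 <= 1 - (t%:num : R) by rewrite subr_ge0.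
move: (t%:num : R) (a : R) (b : R) q0 => q {}a {}b q0 q1.
rewrite ge_max; apply/andP; split.
  have : q * (a - s) <= q * Num.max (a - s) 0.
    by rewrite ler_wpM2l// le_max lexx.
  have : (1 - q) * (b - s) <= (1 - q) * Num.max (b - s) 0.
    by rewrite ler_wpM2l// le_max lexx.
  lra.
by rewrite addr_ge0// mulr_ge0// le_max lexx orbT.
Qed.

Theorem proposition7 (R : realType)
    (d1 : measure_display) (T1 : measurableType d1) (P : probability T1 R)
    (d2 : measure_display) (T2 : measurableType d2) (Q : probability T2 R)
    (X : {RV P >-> R}) (Y : {RV Q >-> R})
    (intY : ('E_Q[fun w => `|Y w|%R] < +oo)%E)
    (domXY : forall phi : R -> R,
      {homo phi : a b / a <= b} ->
      convex_function ([set: R^o] : set (convex_lmodType R^o)) phi ->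
      [/\ expectation_defined P (phi \o X),
          expectation_defined Q (phi \o Y) &
          ('E_P[phi \o X] <= 'E_Q[phi \o Y])%E]) :
  (forall x K : R, 0 < x < 1 -> 1 < K ->
     upper_quantile_mean Y x <= upper_quantile Y (x / K) ->
     let t := upper_quantile_mean Y x in
     (P [set w | (t < X w)%R] <= K%:E * Q [set w | (t <= Y w)%R])%E) /\
  (forall t : R, ('E_Q[Y] < t%:E)%E -> Q [set w | t < Y w] <> 0%E ->
     exists2 x : R, 0 < x < 1 & t = upper_quantile_mean Y x).
Proof.
split=> [x K /andP[x0 x1] K1 meanK|t EYt tailY].
  cbv zeta; set t := upper_quantile_mean Y x in meanK *.
  set s := upper_quantile Y x.
  have x01 : 0 < x < 1 by rewrite x0.
  have xK : 0 < x / K < x.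
    by rewrite divr_gt0 ?ltr_pdivrMr ?ltr_pMr// ?K1 ?x0//; lra.
  have tailX0 : (P [set w | (t < X w)%R] <= x%:E)%E.
    have [] := domXY (fun y => Num.max (y - s) 0) _ (@convex_excess R s).
      move=> a b ab; rewrite ge_max le_max lerB//=.
      by rewrite le_max lexx orbT.
    move=> _ _; rewrite unlock expectation_excess_upper_quantile// => le_excess.
    have st : s <= t by exact: upper_quantile_le_mean.
    have [ts|ts] := eqVneq t s.
      rewrite ts excess_eq0 ?lee_fin 1?ltW//; apply/eqP; rewrite eq_le.
      rewrite integral_ge0 ?andbT; last first.
        by move=> w _; rewrite lee_fin le_max lexx orbT.
      by apply: le_trans le_excess _; rewrite -/t ts subrr mulr0.
    have ts0 : 0 < t - s by rewrite subr_gt0 lt_neqAle eq_sym ts.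
    have := le_trans (excess_markov X s t st) le_excess.
    by rewrite mulrC EFinM lee_pmul2l.
  have tailY : ((x / K)%:E <= Q [set w | (t <= Y w)%R])%E.
    have -> : [set w | t <= Y w] = Y @^-1` `[t, +oo[.
      by apply/seteqP; split => w /=; rewrite in_itv/= andbT.
    rewrite -[leRHS](upper_quantile_distribution Y)//.
    have mu0xK : lebesgue_measure (`]0, x / K] : set R) = (x / K)%:E.
      by rewrite lebesgue_measure_itv/= lte_fin (andP xK).1 sube0.
    (* By monotonicity and [meanK], the upper quantile is at least [t] on all of []0, x / K]]. *)
    rewrite -mu0xK; apply: le_measure; rewrite ?inE//.
      by rewrite setIC; apply: measurable_upper_quantile.
    move=> u /=; rewrite !in_itv/= andbT => /andP[u0 uxK].
    split; last by lra.
    by apply: le_trans meanK _; apply: upper_quantile_nonincreasing => //; lra.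
  have K0 : 0 < K by lra.
  apply: (le_trans tailX0).
  have -> : x%:E = (K%:E * (x / K)%:E)%E.
    by rewrite -EFinM mulrCA divff ?mulr1 ?gt_eqF.
  by apply: lee_wpmul2l tailY; rewrite lee_fin ltW.
(* On []0, 1]] this is [x] times the gap between the mean and [t], so a zero in []0, 1[] is the
   required point. *)
pose Phi x :=
  parameterized_integral lebesgue_measure 0 x (upper_quantile Y) - x * t.
have PhiE x : 0 < x <= 1 -> Phi x = x * (upper_quantile_mean Y x - t).
  by move=> x01; rewrite /Phi parameterized_integral_upper_quantile// mulrBr.
have Phi1 : Phi 1 < 0.
  rewrite PhiE ?ltr01 ?lexx// mul1r subr_lt0 -lte_fin.
  by rewrite upper_quantile_mean1.
have [p [p0 p1 Hp]] : exists p, [/\ 0 < p, p < 1 & t <= upper_quantile Y p].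
  have tailE : Q [set w | t < Y w] = ccdf Y t.
    by congr (Q _); apply/seteqP; split => w /=; rewrite in_itv/= andbT.
  have q01 : (0 < ccdf Y t <= 1)%E.
    by rewrite probability_le1// lt0e measure_ge0 andbT -tailE andbT;
      apply/eqP.
  case: (ccdf Y t) q01 (lt_upper_quantile Y ^~ t) => [q||]; last 2 first.
  - by rewrite leye_eq andbF.
  - by [].
  rewrite lte_fin lee_fin => /andP[q0 q1] HY.
  (* Halving keeps the point strictly below the tail mass [q], as the Galois connection demands, and
     below 1 even when [q] is 1. *)
  exists (q / 2); split; [lra|lra|].
  by apply/ltW; rewrite HY ?lte_fin; lra.
have Phip : 0 <= Phi p.
  rewrite PhiE; last by rewrite p0 ltW.
  rewrite mulr_ge0 ?(ltW p0)// subr_ge0.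
  by apply: le_trans Hp _; apply: upper_quantile_le_mean => //; rewrite p0.
(* The interval starts at [p] rather than 0 because [Phi] also vanishes at 0. *)
have contPhi : {within `[p, 1], continuous Phi}.
  apply: (@continuous_subspaceW _ _ _ (`[0, 1] : set R)).
    by apply: subset_itvr; rewrite bnd_simp ltW.
  apply: within_continuousB.
    apply: parameterized_integral_continuous => //.
    exact: integrable_upper_quantile_cc.
  by apply: continuous_subspaceT => z; exact: mulrr_continuous.
have [] := IVT (ltW p1) contPhi (v := 0).
  by rewrite ge_min (ltW Phi1) orbT le_max Phip.
move=> c; rewrite in_itv/= => /andP[pc c1] Phic.
have c01 : 0 < c < 1.
  rewrite (lt_le_trans p0 pc) lt_neqAle c1 andbT; apply/eqP => c1'.
  by move: Phi1; rewrite -c1' Phic ltxx.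
exists c => //; move: Phic; rewrite PhiE ?(lt_le_trans p0 pc)// => /eqP.
by rewrite mulf_eq0 subr_eq0 gt_eqF ?(andP c01).1//= => /eqP.
Qed.
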